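(* Let $f$ be a smooth real function of one variable and let $g_{\alpha\beta}$ be the Robertson–Walker metric $$ds^2=-dt^2+a^2(t)\left[\frac{dr^2}{1-kr^2}+r^2d\theta^2+r^2\sin^2\theta\,d\varphi^2\right],$$ with $a(t)>0$ smooth and $k\in\{-1,0,1\}$. Let $T_{\alpha\beta}=(\rho+p)u_\alpha u_\beta+p\,g_{\alpha\beta}$, where $u^\alpha=(\partial_t)^\alpha$ and $\rho=\rho(t)$, $p=p(t)$. Suppose that $f'(R)\neq0$ and that the $f(R)$ field equations $$f'(R)R_{\alpha\beta}-\tfrac12 f(R)g_{\alpha\beta}+g_{\alpha\beta}\square f'(R)-\nabla_\alpha\nabla_\beta f'(R)=\kappa T_{\alpha\beta}$$ hold. Then, with $H=\dot a/a$, $$H^2+\frac{k}{a^2}=\frac{1}{3f'(R)}\left[\kappa\rho+\frac{Rf'(R)-f(R)}{2}-3Hf''(R)\dot R\right]$$ and $$2\dot H+3H^2+\frac{k}{a^2}=-\frac{1}{f'(R)}\left[\kappa p+2H\dot R f''(R)+\frac{f(R)-Rf'(R)}{2}+\ddot R f''(R)+\dot R^2 f'''(R)\right].$$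
   Context: Conventions: $\kappa=8\pi G>0$ is a constant, the signature is $(-,+,+,+)$, and the connection is Levi-Civita. The Riemann tensor is $R^{\alpha}{}_{\beta\gamma\delta}=\partial_\gamma\Gamma^\alpha_{\delta\beta}-\partial_\delta\Gamma^\alpha_{\gamma\beta}+\Gamma^\alpha_{\gamma\sigma}\Gamma^\sigma_{\delta\beta}-\Gamma^\alpha_{\sigma\delta}\Gamma^\sigma_{\gamma\beta}$, the Ricci tensor is $R_{\alpha\beta}=R^{\eta}{}_{\alpha\eta\beta}$, and $R=g^{\alpha\beta}R_{\alpha\beta}$; for this metric $R=6[\ddot a/a+(\dot a/a)^2+k/a^2]$. Primes on $f$ are derivatives with respect to $R$, dots are derivatives with respect to $t$, and $\square=\nabla^\sigma\nabla_\sigma$. *)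

(* Defs.v *)
(* Tensor fields are given by their components in a single coordinate chart
   (t, r, theta, phi). *)
From Stdlib Require Import Reals Lra.
From Coquelicot Require Import Coquelicot.
Open Scope R_scope.

Inductive index := it | ir | ith | iph.

Definition index_eq_dec (i j : index) : {i = j} + {i <> j}.
Proof. decide equality. Defined.

Definition kronecker (i j : index) : R := if index_eq_dec i j then 1 else 0.

Definition sum_idx (F : index -> R) : R := F it + F ir + F ith + F iph.

Definition point := index -> R.
Definition scalar_field := point -> R.
Definition covector_field := index -> scalar_field.
Definition tensor_field2 := index -> index -> scalar_field.

Definition update (x : point) (i : index) (s : R) : point :=
  fun j => if index_eq_dec i j then s else x j.

Definition partial (i : index) (F : scalar_field) : scalar_field :=
  fun x => Derive (fun s => F (update x i s)) (x i).

(* Coquelicot's [Derive_n] is total; on an open [D] the condition below says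
   that [h] restricted to [D] is infinitely differentiable. *)
Definition smooth_on (D : R -> Prop) (h : R -> R) : Prop :=
  forall (n : nat) (s : R), D s -> ex_derive_n h n s.

Definition inverse_at (g ginv : tensor_field2) (x : point) : Prop :=
  forall i j, sum_idx (fun s => g i s x * ginv s j x) = kronecker i j.

(* In what follows [g] has components g_{ij} and [ginv] components g^{ij}. *)

(* Levi-Civita connection: [christoffel g ginv c i j] is Gamma^c_{ij}. *)
Definition christoffel (g ginv : tensor_field2) (c i j : index) : scalar_field :=
  fun x => / 2 * sum_idx (fun d => ginv c d x *
    (partial i (g d j) x + partial j (g d i) x - partial d (g i j) x)).

(* [riemann g ginv al be ga de] is R^{al}_{be ga de}. *)
Definition riemann (g ginv : tensor_field2) (al be ga de : index) : scalar_field :=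
  let Gam := christoffel g ginv in
  fun x =>
    partial ga (Gam al de be) x - partial de (Gam al ga be) x
    + sum_idx (fun s => Gam al ga s x * Gam s de be x)
    - sum_idx (fun s => Gam al s de x * Gam s ga be x).

Definition ricci (g ginv : tensor_field2) : tensor_field2 :=
  fun al be x => sum_idx (fun et => riemann g ginv et al et be x).

Definition scalar_curvature (g ginv : tensor_field2) : scalar_field :=
  fun x => sum_idx (fun al => sum_idx (fun be =>
    ginv al be x * ricci g ginv al be x)).

(* [nabla g ginv w al be] is nabla_al w_be. *)
Definition nabla (g ginv : tensor_field2) (w : covector_field) : tensor_field2 :=
  fun al be x =>
    partial al (w be) x - sum_idx (fun s => christoffel g ginv s al be x * w s x).

(* nabla_al nabla_be F; on scalars nabla_be is the partial derivative. *)
Definition nabla2 (g ginv : tensor_field2) (F : scalar_field) : tensor_field2 :=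
  nabla g ginv (fun be => partial be F).

Definition box (g ginv : tensor_field2) (F : scalar_field) : scalar_field :=
  fun x => sum_idx (fun s => sum_idx (fun s' =>
    ginv s s' x * nabla2 g ginv F s' s x)).

Definition fR_equations (kappa : R) (f : R -> R) (g ginv T : tensor_field2)
    (x : point) : Prop :=
  let Rs := scalar_curvature g ginv in
  let f'R : scalar_field := fun y => Derive f (Rs y) in
  forall al be : index,
    f'R x * ricci g ginv al be x - / 2 * f (Rs x) * g al be x
    + g al be x * box g ginv f'R x - nabla2 g ginv f'R al be x
    = kappa * T al be x.

Definition lower (g : tensor_field2) (u : index -> scalar_field) : covector_field :=
  fun al x => sum_idx (fun be => g al be x * u be x).

(* The vector field d/dt. *)
Definition comoving (al : index) : scalar_field := fun _ => kronecker al it.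

Definition perfect_fluid (g : tensor_field2) (rho p : R -> R) : tensor_field2 :=
  fun al be x =>
    (rho (x it) + p (x it)) * lower g comoving al x * lower g comoving be x
    + p (x it) * g al be x.

(* The usual domain of the coordinates, over a set [J] of times. *)
Definition rw_chart (J : R -> Prop) (k : R) (x : point) : Prop :=
  J (x it) /\ 0 < x ir /\ 0 < 1 - k * x ir ^ 2 /\
  0 < x ith < PI /\ 0 < x iph < 2 * PI.

Definition rw_metric (a : R -> R) (k : R) : tensor_field2 :=
  fun i j x =>
    match i, j with
    | it, it => -1
    | ir, ir => a (x it) ^ 2 * (1 / (1 - k * x ir ^ 2))
    | ith, ith => a (x it) ^ 2 * x ir ^ 2
    | iph, iph => a (x it) ^ 2 * (x ir ^ 2 * sin (x ith) ^ 2)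
    | _, _ => 0
    end.

Definition rw_metric_inv (a : R -> R) (k : R) : tensor_field2 :=
  fun i j x =>
    match i, j with
    | it, it => -1
    | ir, ir => (1 - k * x ir ^ 2) / a (x it) ^ 2
    | ith, ith => 1 / (a (x it) ^ 2 * x ir ^ 2)
    | iph, iph => 1 / (a (x it) ^ 2 * (x ir ^ 2 * sin (x ith) ^ 2))
    | _, _ => 0
    end.

Lemma rw_metric_invP (a : R -> R) (k : R) (J : R -> Prop)
  (ha : forall t, J t -> 0 < a t) (x : point) (hx : rw_chart J k x) :
  inverse_at (rw_metric a k) (rw_metric_inv a k) x.
Proof.
destruct hx as [hJ [hr [hk [hth _]]]].
pose proof (Rgt_not_eq _ _ (ha _ hJ)) as ha0.
pose proof (Rgt_not_eq _ _ hr) as hr0.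
pose proof (Rgt_not_eq _ _ hk) as hk0.
pose proof (Rgt_not_eq _ _ (sin_gt_0 _ (proj1 hth) (proj2 hth))) as hs0.
intros i j; destruct i, j; unfold sum_idx, kronecker; simpl index_eq_dec;
  cbv beta iota delta [rw_metric rw_metric_inv]; try ring; field;
  repeat split; assumption.
Qed.

Definition hubble (a : R -> R) (t : R) : R := Derive a t / a t.

(* Main.v *)
(* On the chart R depends on t alone.  Hence f'(R) = phi(t), and
     nabla_t nabla_t phi = phi'',   nabla_r nabla_r phi = - H g_rr phi',
     box phi = - phi'' - 3 H phi'.
   The tt field equation reads
     - 3 f'(R) a''/a + f/2 + 3 H phi' = kappa rho,
   and the rr equation divided by g_rr reads
     f'(R) (a''/a + 2 H^2 + 2 k/a^2) - f/2 - phi'' - 2 H phi' = kappa p.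
   Eliminating a''/a through R = 6 (a''/a + H^2 + k/a^2) and expanding phi', phi''
   by the chain rule gives both identities. *)
Require Import Defs.
From Stdlib Require Import Reals Lra.
From Coquelicot Require Import Coquelicot.
Open Scope R_scope.

(** * Openness of the chart and locality of partial derivatives *)

Lemma update_eq (x : point) (i : index) (s : R) : update x i s i = s.
Proof. unfold update; destruct (index_eq_dec i i); congruence. Qed.

Lemma locally_between (u v s : R) : u < s < v -> locally s (fun y => u < y < v).
Proof.
intros [h1 h2]; apply (open_and _ _ (open_gt u) (open_lt v)); split; assumption.
Qed.

(** Each condition of the chart is open: [J] by hypothesis, the others as strict inequalities
    between continuous functions of one coordinate. *)
Lemma rw_chart_locally (J : R -> Prop) (hJ : open J) (k : R) (x : point)
  (i : index) :
  rw_chart J k x -> locally (x i) (fun s => rw_chart J k (update x i s)).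
Proof.
intros [h1 [h2 [h3 [h4 h5]]]].
unfold rw_chart; destruct i; cbn [update index_eq_dec index_rec index_rect].
- apply filter_imp with J; [| exact (hJ _ h1)].
  intros s hs; repeat split; tauto.
- assert (hc : continuous (fun s => 1 - k * s ^ 2) (x ir)).
  { apply (ex_derive_continuous (fun s => 1 - k * s ^ 2)); auto_derive; exact I. }
  generalize (filter_and _ _ (open_gt 0 (x ir) h2)
    (hc _ (open_gt 0 _ h3))).
  apply filter_imp; intros s [hs1 hs2]; repeat split; tauto.
- generalize (locally_between _ _ _ h4); apply filter_imp.
  intros s hs; repeat split; tauto.
- generalize (locally_between _ _ _ h5); apply filter_imp.
  intros s hs; repeat split; tauto.
Qed.

(** A derivative depends only on values near the point, so a formula established on the chart alone
    can still be differentiated there. *)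
Lemma partial_ext_chart (J : R -> Prop) (hJ : open J) (k : R)
  (F F' : scalar_field) (i : index) (x : point) :
  (forall y, rw_chart J k y -> F y = F' y) ->
  rw_chart J k x -> partial i F x = partial i F' x.
Proof.
intros hFF hx; apply Derive_ext_loc.
generalize (rw_chart_locally J hJ k x i hx); apply filter_imp.
intros s hs; apply hFF; exact hs.
Qed.

Lemma rw_chart_neq0 (a : R -> R) (J : R -> Prop) (ha0 : forall t, J t -> 0 < a t)
  (k : R) (x : point) :
  rw_chart J k x ->
  a (x it) <> 0 /\ x ir <> 0 /\ 1 - k * x ir ^ 2 <> 0 /\ sin (x ith) <> 0.
Proof.
intros [h1 [h2 [h3 [h4 h5]]]]; repeat split; apply Rgt_not_eq.
- exact (ha0 _ h1).
- exact h2.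
- exact h3.
- apply sin_gt_0; tauto.
Qed.

(** * Christoffel symbols of the Robertson-Walker metric *)

(* [rw_christoffel a b k c i j] is Gamma^c_{ij}, where [b] stands for the
   derivative of [a]. *)
Definition rw_christoffel (a b : R -> R) (k : R) (c i j : index) : scalar_field :=
  fun x =>
    let w := 1 - k * x ir ^ 2 in
    match c, i, j with
    | it, ir, ir => a (x it) * b (x it) / w
    | it, ith, ith => a (x it) * b (x it) * x ir ^ 2
    | it, iph, iph => a (x it) * b (x it) * x ir ^ 2 * sin (x ith) ^ 2
    | ir, it, ir | ir, ir, it | ith, it, ith | ith, ith, it
    | iph, it, iph | iph, iph, it => b (x it) / a (x it)
    | ir, ir, ir => k * x ir / w
    | ir, ith, ith => - (x ir * w)
    | ir, iph, iph => - (x ir * w * sin (x ith) ^ 2)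
    | ith, ir, ith | ith, ith, ir | iph, ir, iph | iph, iph, ir => / x ir
    | ith, iph, iph => - (sin (x ith) * cos (x ith))
    | iph, ith, iph | iph, iph, ith => cos (x ith) / sin (x ith)
    | _, _, _ => 0
    end.

(** The index [d] is the direction of differentiation, and [b] stands for a'. *)
Definition rw_metric_partial (a b : R -> R) (k : R) (d i j : index) : scalar_field :=
  fun x =>
    let w := 1 - k * x ir ^ 2 in
    match d, i, j with
    | it, ir, ir => 2 * a (x it) * b (x it) / w
    | it, ith, ith => 2 * a (x it) * b (x it) * x ir ^ 2
    | it, iph, iph => 2 * a (x it) * b (x it) * (x ir ^ 2 * sin (x ith) ^ 2)
    | ir, ir, ir => a (x it) ^ 2 * (2 * k * x ir / w ^ 2)
    | ir, ith, ith => a (x it) ^ 2 * (2 * x ir)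
    | ir, iph, iph => a (x it) ^ 2 * (2 * x ir * sin (x ith) ^ 2)
    | ith, iph, iph => a (x it) ^ 2 * (x ir ^ 2 * (2 * sin (x ith) * cos (x ith)))
    | _, _, _ => 0
    end.

Ltac reduce_components :=
  cbn [update index_eq_dec index_rec index_rect rw_metric rw_metric_inv
       rw_metric_partial rw_christoffel].

(* [auto_derive] and [field] return side conditions whose left-hand sides equal
   those of the hypotheses only up to [ring]. *)
Ltac by_neq0 :=
  try assumption; try exact I;
  match goal with
  | h : _ <> 0 |- _ <> 0 =>
      let hc := fresh in intro hc; apply h; rewrite <- hc; ring
  end.

Ltac eta_derive :=
  repeat match goal with
  | |- context [Derive (fun y : R => ?h y)] => change (fun y : R => h y) with h
  end.

Lemma partial_rw_metric (a b : R -> R) (J : R -> Prop)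
  (ha : forall t, J t -> is_derive a t (b t)) (ha0 : forall t, J t -> 0 < a t)
  (k : R) (d i j : index) (x : point) :
  rw_chart J k x ->
  partial d (rw_metric a k i j) x = rw_metric_partial a b k d i j x.
Proof.
intros hx.
destruct (rw_chart_neq0 a J ha0 k x hx) as [hn1 [hn2 [hn3 hn4]]].
pose proof (ha _ (proj1 hx)) as hda.
pose proof (is_derive_unique _ _ _ hda) as hDa.
pose proof (ex_intro _ _ hda : ex_derive a (x it)) as hEa.
unfold partial; destruct d, i, j; reduce_components;
  try exact (Derive_const _ _); apply is_derive_unique; auto_derive;
  try (repeat split; by_neq0); eta_derive; rewrite ?hDa; field;
  repeat split; by_neq0.
Qed.

Lemma christoffel_rw (a b : R -> R) (J : R -> Prop)
  (ha : forall t, J t -> is_derive a t (b t)) (ha0 : forall t, J t -> 0 < a t)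
  (k : R) (c i j : index) (x : point) :
  rw_chart J k x ->
  christoffel (rw_metric a k) (rw_metric_inv a k) c i j x
  = rw_christoffel a b k c i j x.
Proof.
intros hx.
destruct (rw_chart_neq0 a J ha0 k x hx) as [hn1 [hn2 [hn3 hn4]]].
unfold christoffel, sum_idx.
rewrite !(partial_rw_metric a b J ha ha0 k _ _ _ x hx).
destruct c, i, j; reduce_components; try ring; field; repeat split; assumption.
Qed.

Lemma partial_christoffel_rw (a b : R -> R) (J : R -> Prop) (hJ : open J)
  (ha : forall t, J t -> is_derive a t (b t)) (ha0 : forall t, J t -> 0 < a t)
  (k : R) (d c i j : index) (x : point) :
  rw_chart J k x ->
  partial d (christoffel (rw_metric a k) (rw_metric_inv a k) c i j) x
  = partial d (rw_christoffel a b k c i j) x.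
Proof.
apply (partial_ext_chart J hJ); intros y hy.
apply (christoffel_rw a b J ha ha0); exact hy.
Qed.

(** * Ricci tensor and scalar curvature *)

(** Here [c] stands for a''. The three spatial entries are (q / a^2) g_ii with the same [q], which
    reflects isotropy. *)
Definition rw_ricci_diag (a b c : R -> R) (k : R) (i : index) : scalar_field :=
  fun x =>
    let w := 1 - k * x ir ^ 2 in
    let q := a (x it) * c (x it) + 2 * b (x it) ^ 2 + 2 * k in
    match i with
    | it => -3 * (c (x it) / a (x it))
    | ir => q / w
    | ith => q * x ir ^ 2
    | iph => q * (x ir ^ 2 * sin (x ith) ^ 2)
    end.

(* The two derivative terms d_e Gamma^e_{ii} - d_i Gamma^e_{ei} of R^e_{iei}. *)
Definition rw_riemann_linear (a b c : R -> R) (k : R) (e i : index) : scalar_field :=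
  fun x =>
    let w := 1 - k * x ir ^ 2 in
    let v := b (x it) ^ 2 + a (x it) * c (x it) in
    let h' := c (x it) / a (x it) - (b (x it) / a (x it)) ^ 2 in
    match e, i with
    | it, it | ir, ir | ith, ith | iph, iph => 0
    | ir, it | ith, it | iph, it => - h'
    | it, ir => v / w
    | it, ith => v * x ir ^ 2
    | it, iph => v * x ir ^ 2 * sin (x ith) ^ 2
    | ith, ir | iph, ir => / x ir ^ 2
    | ir, ith => 3 * k * x ir ^ 2 - 1
    | ir, iph => (3 * k * x ir ^ 2 - 1) * sin (x ith) ^ 2
    | iph, ith => / sin (x ith) ^ 2
    | ith, iph => sin (x ith) ^ 2 - cos (x ith) ^ 2
    end.

Lemma partial_rw_christoffel_diag (a b c : R -> R) (J : R -> Prop)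
  (ha : forall t, J t -> is_derive a t (b t))
  (hb : forall t, J t -> is_derive b t (c t)) (ha0 : forall t, J t -> 0 < a t)
  (k : R) (e i : index) (x : point) :
  rw_chart J k x ->
  partial e (rw_christoffel a b k e i i) x - partial i (rw_christoffel a b k e e i) x
  = rw_riemann_linear a b c k e i x.
Proof.
intros hx.
destruct (rw_chart_neq0 a J ha0 k x hx) as [hn1 [hn2 [hn3 hn4]]].
pose proof (ha _ (proj1 hx)) as hda.
pose proof (is_derive_unique _ _ _ hda) as hDa.
pose proof (ex_intro _ _ hda : ex_derive a (x it)) as hEa.
pose proof (hb _ (proj1 hx)) as hdb.
pose proof (is_derive_unique _ _ _ hdb) as hDb.
pose proof (ex_intro _ _ hdb : ex_derive b (x it)) as hEb.
assert (hcs : cos (x ith) ^ 2 = 1 - sin (x ith) ^ 2).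
{ generalize (sin2_cos2 (x ith)); unfold Rsqr; lra. }
(* For e = i the two terms coincide. For e <> i exactly one of the two Christoffel symbols is
   identically zero, so a single derivative remains. *)
destruct e, i; try apply Rminus_diag_eq, eq_refl;
  unfold partial, rw_riemann_linear; reduce_components;
  rewrite ?Derive_const;
  match goal with
  | |- 0 - Derive ?F ?y = ?l =>
      cut (Derive F y = - l); [lra | apply is_derive_unique]
  | |- Derive ?F ?y - 0 = ?l =>
      cut (Derive F y = l); [lra | apply is_derive_unique]
  end;
  auto_derive; try (repeat split; by_neq0);
  eta_derive; rewrite ?hDa, ?hDb; field [hcs]; repeat split; by_neq0.
Qed.

Lemma ricci_rw_diag (a b c : R -> R) (J : R -> Prop) (hJ : open J)
  (ha : forall t, J t -> is_derive a t (b t))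
  (hb : forall t, J t -> is_derive b t (c t)) (ha0 : forall t, J t -> 0 < a t)
  (k : R) (i : index) (x : point) :
  rw_chart J k x ->
  ricci (rw_metric a k) (rw_metric_inv a k) i i x = rw_ricci_diag a b c k i x.
Proof.
intros hx.
destruct (rw_chart_neq0 a J ha0 k x hx) as [hn1 [hn2 [hn3 hn4]]].
assert (hcs : cos (x ith) ^ 2 = 1 - sin (x ith) ^ 2).
{ generalize (sin2_cos2 (x ith)); unfold Rsqr; lra. }
unfold ricci, riemann, sum_idx; cbv zeta.
rewrite !(partial_christoffel_rw a b J hJ ha ha0 k _ _ _ _ x hx).
rewrite !(christoffel_rw a b J ha ha0 k _ _ _ x hx).
(* In R_ii the derivative terms occur exactly in the pairs d_e Gamma^e_{ii} - d_i Gamma^e_{ei};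
   after this only products of Christoffel symbols remain. *)
rewrite !(partial_rw_christoffel_diag a b c J ha hb ha0 k _ _ x hx).
destruct i; unfold rw_riemann_linear, rw_ricci_diag; reduce_components;
  field [hcs]; repeat split; assumption.
Qed.

Definition rw_scalar (a b c : R -> R) (k t : R) : R :=
  6 * (c t / a t + (b t / a t) ^ 2 + k / a t ^ 2).

(** The inverse metric is diagonal, so the trace is 3 a''/a + 3 q / a^2 with q = a a'' + 2 a'^2 + 2
    k. *)
Lemma scalar_curvature_rw (a b c : R -> R) (J : R -> Prop) (hJ : open J)
  (ha : forall t, J t -> is_derive a t (b t))
  (hb : forall t, J t -> is_derive b t (c t)) (ha0 : forall t, J t -> 0 < a t)
  (k : R) (x : point) :
  rw_chart J k x ->
  scalar_curvature (rw_metric a k) (rw_metric_inv a k) x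
  = rw_scalar a b c k (x it).
Proof.
intros hx.
destruct (rw_chart_neq0 a J ha0 k x hx) as [hn1 [hn2 [hn3 hn4]]].
unfold scalar_curvature, sum_idx.
rewrite !(ricci_rw_diag a b c J hJ ha hb ha0 k _ x hx).
unfold rw_scalar, rw_ricci_diag; reduce_components.
field; repeat split; assumption.
Qed.

(** * Second covariant derivatives of a function of time *)

(** Only the t-derivative of [F] survives, so the connection enters through Gamma^t_{ii}, which is 0
    for i = t and H g_ii for spatial i. *)
Lemma nabla2_rw_diag (a b : R -> R) (J : R -> Prop) (hJ : open J)
  (ha : forall t, J t -> is_derive a t (b t)) (ha0 : forall t, J t -> 0 < a t)
  (k : R) (F : scalar_field) (phi phi1 phi2 : R -> R)
  (hF : forall x, rw_chart J k x -> F x = phi (x it))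
  (hphi : forall t, J t -> is_derive phi t (phi1 t))
  (hphi1 : forall t, J t -> is_derive phi1 t (phi2 t))
  (i : index) (x : point) :
  rw_chart J k x ->
  nabla2 (rw_metric a k) (rw_metric_inv a k) F i i x
  = match i with
    | it => phi2 (x it)
    | _ => - (b (x it) / a (x it)) * rw_metric a k i i x * phi1 (x it)
    end.
Proof.
intros hx.
destruct (rw_chart_neq0 a J ha0 k x hx) as [hn1 [hn2 [hn3 hn4]]].
assert (h1 : forall j y, rw_chart J k y ->
  partial j F y = match j with it => phi1 (y it) | _ => 0 end).
{ intros j y hy.
  rewrite (partial_ext_chart J hJ k F (fun z => phi (z it)) j y hF hy).
  unfold partial; destruct j; reduce_components; try apply Derive_const.
  apply is_derive_unique, hphi, hy. }
(* Since [h1] holds on the whole chart, and not just at [x], it can be differentiated once more. *)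
assert (h2 : forall j, partial j (partial j F) x
  = match j with it => phi2 (x it) | _ => 0 end).
{ intros j.
  rewrite (partial_ext_chart J hJ k _ _ j x (h1 j) hx).
  unfold partial; destruct j; reduce_components; try apply Derive_const.
  apply is_derive_unique, hphi1, hx. }
unfold nabla2, nabla, sum_idx.
rewrite h2, !(h1 _ x hx).
rewrite !(christoffel_rw a b J ha ha0 k _ _ _ x hx).
destruct i; reduce_components; field; repeat split; assumption.
Qed.

(** In the trace g^tt = -1 contributes - phi'', and each of the three spatial directions contributes
    - H phi'. *)
Lemma box_rw (a b : R -> R) (J : R -> Prop) (hJ : open J)
  (ha : forall t, J t -> is_derive a t (b t)) (ha0 : forall t, J t -> 0 < a t)
  (k : R) (F : scalar_field) (phi phi1 phi2 : R -> R)
  (hF : forall x, rw_chart J k x -> F x = phi (x it))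
  (hphi : forall t, J t -> is_derive phi t (phi1 t))
  (hphi1 : forall t, J t -> is_derive phi1 t (phi2 t)) (x : point) :
  rw_chart J k x ->
  box (rw_metric a k) (rw_metric_inv a k) F x
  = - phi2 (x it) - 3 * (b (x it) / a (x it)) * phi1 (x it).
Proof.
intros hx.
destruct (rw_chart_neq0 a J ha0 k x hx) as [hn1 [hn2 [hn3 hn4]]].
unfold box, sum_idx.
rewrite !(nabla2_rw_diag a b J hJ ha ha0 k F phi phi1 phi2 hF hphi hphi1 _ x hx).
reduce_components; field; repeat split; assumption.
Qed.

(** * Time derivatives of the scalar curvature, and the final elimination *)

(** The expanded time derivative of [rw_scalar], with [d] for a'''. *)
Definition rw_scalar1 (a b c d : R -> R) (k t : R) : R :=
  6 * (d t / a t + b t * c t / a t ^ 2 - 2 * b t ^ 3 / a t ^ 3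
       - 2 * k * b t / a t ^ 3).

Lemma is_derive_rw_scalar (a b c d : R -> R) (k t : R) :
  a t <> 0 -> is_derive a t (b t) -> is_derive b t (c t) -> is_derive c t (d t) ->
  is_derive (rw_scalar a b c k) t (rw_scalar1 a b c d k t).
Proof.
intros h0 ha hb hc.
pose proof (is_derive_unique _ _ _ ha) as hDa.
pose proof (is_derive_unique _ _ _ hb) as hDb.
pose proof (is_derive_unique _ _ _ hc) as hDc.
pose proof (ex_intro _ _ ha : ex_derive a t) as hEa.
pose proof (ex_intro _ _ hb : ex_derive b t) as hEb.
pose proof (ex_intro _ _ hc : ex_derive c t) as hEc.
unfold rw_scalar, rw_scalar1; auto_derive.
- repeat split; try assumption; apply (pow_nonzero _ 2 h0).
- eta_derive; rewrite hDa, hDb, hDc; field; assumption.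
Qed.

Lemma ex_derive_rw_scalar1 (a b c d : R -> R) (k t : R) :
  a t <> 0 -> ex_derive a t -> ex_derive b t -> ex_derive c t -> ex_derive d t ->
  ex_derive (rw_scalar1 a b c d k) t.
Proof.
intros h0 ha hb hc hd; unfold rw_scalar1; auto_derive.
repeat split; try assumption;
  first [apply (pow_nonzero _ 2 h0) | apply (pow_nonzero _ 3 h0)].
Qed.

(* [b], [c] stand for a', a'' and [phi1], [phi2] for the first two time
   derivatives of f'(R); the last two hypotheses are the tt equation and the rr
   equation divided by g_rr. *)
Lemma friedmann_algebra (kappa k A b c r0 f0 f1 phi1 phi2 rho p : R) :
  A <> 0 -> f1 <> 0 ->
  r0 = 6 * (c / A + (b / A) ^ 2 + k / A ^ 2) ->
  f1 * (-3 * (c / A)) + f0 / 2 + 3 * (b / A) * phi1 = kappa * rho ->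
  f1 * ((A * c + 2 * b ^ 2 + 2 * k) / A ^ 2) - f0 / 2 - phi2 - 2 * (b / A) * phi1
    = kappa * p ->
  (b / A) ^ 2 + k / A ^ 2
    = 1 / (3 * f1) * (kappa * rho + (r0 * f1 - f0) / 2 - 3 * (b / A) * phi1)
  /\
  2 * (c / A - (b / A) ^ 2) + 3 * (b / A) ^ 2 + k / A ^ 2
    = - (1 / f1) * (kappa * p + 2 * (b / A) * phi1 + (f0 - r0 * f1) / 2 + phi2).
Proof.
(* Substituting for [r0], kappa rho and kappa p leaves two identities between rational functions. *)
intros hA hf1 -> <- <-; split; field; split; assumption.
Qed.

(** * The generalized Friedmann equations *)

Theorem mainTheorem2
  (G kappa : R) (hkappa : kappa = 8 * PI * G) (hkappa0 : 0 < kappa)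
  (U : R -> Prop) (hU : open U) (f : R -> R) (hf : smooth_on U f)
  (J : R -> Prop) (hJ : open J)
  (a : R -> R) (ha : smooth_on J a) (ha0 : forall t : R, J t -> 0 < a t)
  (k : R) (hk : k = -1 \/ k = 0 \/ k = 1)
  (rho p : R -> R) :
  let g := rw_metric a k in
  let ginv := rw_metric_inv a k in
  let Rs := scalar_curvature g ginv in
  let H := hubble a in
  (forall x : point, rw_chart J k x -> U (Rs x)) ->
  (forall x : point, rw_chart J k x -> Derive f (Rs x) <> 0) ->
  (forall x : point, rw_chart J k x ->
     fR_equations kappa f g ginv (perfect_fluid g rho p) x) ->
  forall x : point, rw_chart J k x ->
    let t := x it in
    let R0 := Rs x in
    let R1 := partial it Rs x in
    let R2 := partial it (partial it Rs) x in
    let f0 := f R0 in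
    let f1 := Derive f R0 in
    let f2 := Derive_n f 2 R0 in
    let f3 := Derive_n f 3 R0 in
    H t ^ 2 + k / a t ^ 2
      = 1 / (3 * f1) * (kappa * rho t + (R0 * f1 - f0) / 2 - 3 * H t * f2 * R1)
    /\
    2 * Derive H t + 3 * H t ^ 2 + k / a t ^ 2
      = - (1 / f1) * (kappa * p t + 2 * H t * R1 * f2 + (f0 - R0 * f1) / 2
                      + R2 * f2 + R1 ^ 2 * f3).
Proof.
intros g ginv Rs H hUR hf' heq x hx t R0 R1 R2 f0 f1 f2 f3.
set (b := Derive a); set (c := Derive_n a 2); set (d := Derive_n a 3).
(* [ex_derive_n h n] asserts that the derivative of order n - 1 is differentiable, hence the orders
   1, 2, 3 for a, a', a''; the same shift applies to [f] below. *)
assert (hb' : forall s, J s -> is_derive a s (b s)).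
{ intros s hs; apply Derive_correct; exact (ha 1%nat s hs). }
assert (hc' : forall s, J s -> is_derive b s (c s)).
{ intros s hs; apply Derive_correct; exact (ha 2%nat s hs). }
assert (hd' : forall s, J s -> is_derive c s (d s)).
{ intros s hs; apply Derive_correct; exact (ha 3%nat s hs). }
assert (hne : forall s, J s -> a s <> 0).
{ intros s hs; apply Rgt_not_eq, ha0, hs. }
set (S := rw_scalar a b c k); set (S1 := rw_scalar1 a b c d k).
set (S2 := Derive S1).
assert (hS : forall s, J s -> is_derive S s (S1 s)).
{ intros s hs; apply is_derive_rw_scalar; auto. }
assert (hS1 : forall s, J s -> is_derive S1 s (S2 s)).
{ intros s hs; apply Derive_correct, ex_derive_rw_scalar1; auto.
  - exact (ha 1%nat s hs).
  - exact (ha 2%nat s hs).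
  - exact (ha 3%nat s hs).
  - exact (ha 4%nat s hs). }
assert (hRs : forall y, rw_chart J k y -> Rs y = S (y it)).
{ intros y hy; apply (scalar_curvature_rw a b c J hJ); auto. }
(* Every time in [J] is the time of a point of the chart. *)
assert (hUS : forall s, J s -> U (S s)).
{ intros s hs.
  assert (hy : rw_chart J k (update x it s)) by (split; [exact hs | exact (proj2 hx)]).
  generalize (hUR _ hy); rewrite (hRs _ hy), update_eq; trivial. }
(* f'(R) as a function of time, with its first two derivatives R' f'' and R'' f'' + R'^2 f''' from
   the chain and product rules. *)
set (phi := fun s => Derive f (S s)).
set (phi1 := fun s => S1 s * Derive_n f 2 (S s)).
set (phi2 := fun s => S2 s * Derive_n f 2 (S s) + S1 s ^ 2 * Derive_n f 3 (S s)).
assert (hphi : forall s, J s -> is_derive phi s (phi1 s)).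
{ intros s hs; apply (is_derive_comp (Derive f) S); [| exact (hS s hs)].
  apply Derive_correct; exact (hf 2%nat _ (hUS s hs)). }
assert (hphi1 : forall s, J s -> is_derive phi1 s (phi2 s)).
{ intros s hs.
  replace (phi2 s) with
    (S2 s * Derive_n f 2 (S s) + S1 s * (S1 s * Derive_n f 3 (S s)))
    by (unfold phi2; ring).
  apply (is_derive_mult S1 (fun u => Derive_n f 2 (S u)));
    [exact (hS1 s hs) | | exact Rmult_comm].
  apply (is_derive_comp (Derive_n f 2) S); [| exact (hS s hs)].
  apply Derive_correct; exact (hf 3%nat _ (hUS s hs)). }
(* Applied first to R and then to its t-derivative, this identifies [R1] and [R2] with ordinary
   derivatives of [S]. *)
assert (hpartial : forall (h h1 : R -> R) (F : scalar_field),
  (forall y, rw_chart J k y -> F y = h (y it)) ->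
  (forall s, J s -> is_derive h s (h1 s)) ->
  forall y, rw_chart J k y -> partial it F y = h1 (y it)).
{ intros h h1 F hF hh y hy.
  rewrite (partial_ext_chart J hJ k F (fun z => h (z it)) it y hF hy).
  apply is_derive_unique, hh, hy. }
assert (hR1 : forall y, rw_chart J k y -> partial it Rs y = S1 (y it))
  by (apply (hpartial S); auto).
assert (hR2 : R2 = S2 t) by (apply (hpartial S1); auto).
assert (hF : forall y, rw_chart J k y -> Derive f (Rs y) = phi (y it))
  by (intros y hy; unfold phi; rewrite hRs; auto).
assert (hJt : J t) by exact (proj1 hx).
destruct (rw_chart_neq0 a J ha0 k x hx) as [hn1 [hn2 [hn3 hn4]]].
assert (hH : Derive H t = c t / a t - (b t / a t) ^ 2).
{ apply is_derive_unique; unfold H, hubble; fold b.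
  replace (c t / a t - (b t / a t) ^ 2) with ((c t * a t - b t * b t) / a t ^ 2)
    by (field; exact (hne t hJt)).
  apply is_derive_div; auto. }
assert (h1 : partial it Rs x = S1 t) by exact (hR1 x hx).
assert (hRx : Rs x = S t) by exact (hRs x hx).
pose proof (heq x hx it it) as htt; pose proof (heq x hx ir ir) as hrr.
unfold fR_equations in htt, hrr; cbv zeta in htt, hrr.
fold Rs in htt, hrr; unfold g, ginv in htt, hrr.
rewrite (ricci_rw_diag a b c J hJ hb' hc' ha0 k _ x hx),
  (box_rw a b J hJ hb' ha0 k _ phi phi1 phi2 hF hphi hphi1 x hx),
  (nabla2_rw_diag a b J hJ hb' ha0 k _ phi phi1 phi2 hF hphi hphi1 _ x hx) in htt.
rewrite (ricci_rw_diag a b c J hJ hb' hc' ha0 k _ x hx),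
  (box_rw a b J hJ hb' ha0 k _ phi phi1 phi2 hF hphi hphi1 x hx),
  (nabla2_rw_diag a b J hJ hb' ha0 k _ phi phi1 phi2 hF hphi hphi1 _ x hx) in hrr.
(* Lowering the index gives u_t = -1 and u_r = 0, so T_tt = rho and T_rr = p g_rr. *)
unfold perfect_fluid, lower, comoving, kronecker, sum_idx, rw_ricci_diag
  in htt, hrr.
cbn [index_eq_dec index_rec index_rect rw_metric] in htt, hrr.
fold t R0 in htt, hrr; fold f0 f1 in htt, hrr; fold t in hn1.
assert (hf1 : f1 <> 0) by exact (hf' x hx).
destruct (friedmann_algebra kappa k (a t) (b t) (c t) R0 f0 f1 (phi1 t) (phi2 t)
  (rho t) (p t)) as [hA hB]; auto.
(* In the tt equation phi'' cancels between the box term and nabla_t nabla_t phi. *)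
- match type of htt with ?l = _ => transitivity l end;
    [field; exact hn1 | rewrite htt; ring].
(* The factor is g_rr, nonzero on the chart; multiplying by it recovers the rr equation. *)
- apply (Rmult_eq_reg_l (a t ^ 2 * (1 / (1 - k * x ir ^ 2)))).
  + match type of hrr with ?l = _ => transitivity l end;
      [field; split; assumption | rewrite hrr; unfold t; ring].
  + apply Rmult_integral_contrapositive_currified;
      [apply (pow_nonzero _ 2 hn1) |].
    unfold Rdiv; rewrite Rmult_1_l; apply Rinv_neq_0_compat; exact hn3.
(* Expanding [phi1] and [phi2] turns the time derivatives of f'(R) into the f'' and f''' terms of
   the claim. *)
- unfold R1, f2, f3, phi1, phi2 in *; rewrite h1, hR2, hH.
  unfold R0 in *; rewrite hRx in *.
  unfold H, hubble; fold b; split.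
  + rewrite hA; field; repeat split; assumption.
  + rewrite hB; field; repeat split; assumption.
Qed.
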